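(* Let $s,t>0$. Let $A$ be a compact ultrametric space with positive $t$-dimensional Hausdorff measure and let $B$ be a nonempty compact metric space with $\delta^s(B)<\infty$. (1) There exist a compact $A'\subset A$ and a $t/s$-Hölder onto map $f\colon A'\to B$. (2) If $t=s$ then $A$ can be mapped onto $B$ by a Lipschitz map.
   Context: A metric space $(X,d)$ is ultrametric if $d(x,y)\le\max\{d(x,z),d(y,z)\}$ for all $x,y,z\in X$. Let $(X,d)$ be a metric space and $s>0$. For $n\ge1$ let $\mathrm{Sym}(n)$ be the set of bijections $\{1,\dots,n\}\to\{1,\dots,n\}$. For $x_1,\dots,x_n\in X$ define $$Z^s(x_1,\dots,x_n)=\max\left\{\sum_{j=1}^{k-1}(d(x_{i_j},x_{i_{j+1}}))^s: 1=i_1<\dots<i_k=n\right\},$$ $$\delta^s(X)=\sup\left\{\min_{\pi\in\mathrm{Sym}(n)}Z^s(x_{\pi(1)},\dots,x_{\pi(n)}): x_1,\dots,x_n\in X,\ n\ge1\right\}\in[0,\infty].$$ For $\alpha>0$, a map $f$ between metric spaces is $\alpha$-Hölder if there is a finite $C$ with $d_Y(f(x),f(z))\le C\,d_X(x,z)^\alpha$ for all $x,z$ in its domain ($\alpha>1$ is allowed); Lipschitz means $1$-Hölder. *)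

(* Defs.v *)
From mathcomp Require Import all_boot all_order all_algebra all_fingroup.
From mathcomp Require Import all_classical all_reals all_analysis.
Set Implicit Arguments.
Unset Strict Implicit.
Unset Printing Implicit Defensive.
Import Order.TTheory GRing.Theory Num.Theory.
Local Open Scope classical_set_scope.
Local Open Scope ring_scope.

Definition ultrametric (R : realType) (X : metricType R) : Prop :=
  forall x y z : X, mdist x y <= Num.max (mdist x z) (mdist y z).

(* The point 0 only matters for the empty set, whose diameter is then 0. *)
Definition ediam (R : realType) (X : metricType R) (E : set X) : \bar R :=
  ereal_sup ([set 0%E] `|`
    [set (mdist xy.1 xy.2)%:E | xy in E `*` E]).

Definition hausdorff_content (R : realType) (X : metricType R) (t e : R)
    (E : set X) : \bar R :=
  ereal_inf [set (\sum_(k <oo) (ediam (U k) `^ t))%E | U in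
    [set U : (set X)^nat | (forall k, ediam (U k) <= e%:E)%E /\
                           E `<=` \bigcup_k U k]].

(* [hausdorff_content t e E] is nonincreasing in e, so this supremum is the
   limit as e tends to 0. No normalizing constant is used. *)
Definition hausdorff_measure (R : realType) (X : metricType R) (t : R)
    (E : set X) : \bar R :=
  ereal_sup [set hausdorff_content t e E | e in [set e : R | 0 < e]].

(* The points x_1, ..., x_m with m = n + 1 are x : 'I_n.+1 -> X. A chain
   1 = i_1 < ... < i_(k+1) = m is ord0 :: p, where p has k entries; k <= n
   because the chain is strictly increasing. The sums are nonnegative, so 0 is
   neutral for these maxima. *)
Definition chain_max (R : realType) (X : metricType R) (s : R) (n : nat)
    (x : 'I_n.+1 -> X) : R :=
  \big[Num.max/0]_(k < n.+1)
  \big[Num.max/0]_(p : k.-tuple 'I_n.+1 |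
      path (fun i j : 'I_n.+1 => (i < j)%N) ord0 p && (last ord0 p == ord_max))
    \sum_(j < k) mdist (x (nth ord0 (ord0 :: p) j))
                       (x (nth ord0 (ord0 :: p) j.+1)) `^ s.

(* The default value of the minimum is the one at the identity permutation. *)
Definition order_min (R : realType) (X : metricType R) (s : R) (n : nat)
    (x : 'I_n.+1 -> X) : R :=
  \big[Num.min/chain_max s x]_(pi : 'S_n.+1) chain_max s (x \o pi).

(* This is nonnegative for nonempty X (one-point families give 0), and -oo for
   empty X. *)
Definition delta (R : realType) (s : R) (X : metricType R) : \bar R :=
  ereal_sup [set z | exists (n : nat) (x : 'I_n.+1 -> X),
                       z = (order_min s x)%:E].

Definition hoelder_on (R : realType) (X Y : metricType R) (alpha : R)
    (D : set X) (f : X -> Y) : Prop :=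
  exists C : R, forall x z, D x -> D z ->
    mdist (f x) (f z) <= C * mdist x z `^ alpha.

Definition lipschitz_map (R : realType) (X Y : metricType R) (f : X -> Y)
    : Prop := hoelder_on 1 [set: X] f.

(* Main.v *)
(* Order the ultrametric space A totally so that balls are convex. With N the
   t-dimensional content (infimum of the sums of diam^t over all countable
   covers), F(x) = N{y <= x} satisfies |F(x) - F(z)| <= d(x,z)^t, because the
   interval between x and z has diameter at most d(x,z), and F maps A onto
   [0, N(A)], where N(A) > 0; no Frostman measure is needed. Conversely, an
   ordering of a finite subset of B with Z^s at most D yields a potential g with
   values in [0, D] and d(x,y)^s <= g(y) - g(x) for x before y. Matching
   multiples of g with values of F gives maps from finite subsets of B to A
   that expand in the right way; by Tychonoff there is such a map on all of B.
   Its inverse extends to the closure of its range and then to A, since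
   nearest-point maps to compact subsets of an ultrametric space can be chosen
   1-Lipschitz. Hence one map defined on all of A serves for both parts. *)
Require Import Defs.
From mathcomp Require Import all_boot all_order all_algebra all_fingroup.
From mathcomp Require Import all_classical all_reals all_analysis wochoice.
From mathcomp Require Import lra.
Set Implicit Arguments.
Unset Strict Implicit.
Unset Printing Implicit Defensive.
Import Order.TTheory GRing.Theory Num.Theory.
Import numFieldNormedType.Exports.
Local Open Scope classical_set_scope.
Local Open Scope ring_scope.

(** * Convex total orders on ultrametric spaces *)

(** Transitivity comes from the least element of {x, y, z}: if it is y or z, antisymmetry identifies
    it with the point before it. *)
Lemma exists_total_order (T : eqType) :
  exists le : rel T, [/\ transitive le, antisymmetric le & total le].
Proof.
have [le wo] := well_ordering_principle T.
have wole : wo_chain le predT by apply: withinW.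
have tot : total le by move=> x y; apply: (wo_chainW wole).
have anti : antisymmetric le by move=> x y; apply: (wo_chain_antisymmetric wole).
exists le; split=> // y x z xy yz.
have [|m [[]]] := wo (mem [:: x; y; z]); first by exists x; rewrite inE eqxx.
move=> + lb _; rewrite !inE => /or3P[]/eqP mE; rewrite mE in lb.
- by apply: lb; rewrite !inE eqxx !orbT.
- by rewrite (anti x y) // xy lb // !inE eqxx.
- by rewrite -(anti y z) // yz lb // !inE eqxx !orbT.
Qed.

Lemma ultrametric_ball_eq (R : realType) (X : metricType R) (x y : X) (r : R) :
  ultrametric X -> mdist x y < r -> ball x r = ball y r.
Proof.
move=> um; wlog suff sub : x y / mdist x y < r -> ball x r `<=` ball y r.
  by move=> xy; apply/seteqP; split; apply: sub; rewrite // metric_sym.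
move=> xy w; rewrite !ballEmdist /= => xw.
by rewrite (le_lt_trans (um _ _ x)) // gt_max metric_sym xy metric_sym.
Qed.

(** In an ultrametric space the last clause says exactly that balls are order-convex. *)
Definition convex_order (R : realType) (X : metricType R) (le : rel X) : Prop :=
  [/\ transitive le, antisymmetric le, total le &
    forall x y z, le x y -> le y z ->
      Num.max (mdist x y) (mdist y z) <= mdist x z].

(* Distinct points x and y lie in distinct balls of radius mdist x y: compare
   these balls in a total order on all sets. *)
Lemma ultrametric_convex_order (R : realType) (X : metricType R) :
  ultrametric X -> exists le : rel X, convex_order le.
Proof.
move=> um; have [le0 [tr0 anti0 tot0]] := exists_total_order (set X).
pose ba (x y : X) := ball x (mdist x y).
have ba_neq x y : x != y -> ba x y != ba y x.
  move=> xy; apply/negP => /eqP /seteqP[/(_ x) + _]; rewrite /ba !ballEmdist /=.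
  by rewrite mdistxx mdist_gt0 => /(_ xy); rewrite ltxx.
pose lt (x y : X) := (x != y) && le0 (ba x y) (ba y x).
have lt_asym x y : lt x y -> ~~ lt y x.
  move=> /andP[xy h]; apply/negP => /andP[_ h'].
  by move/eqP: (ba_neq _ _ xy); apply; apply: anti0; rewrite h h'.
have key x y z : lt x y -> lt y z ->
    lt x z /\ mdist x z = Num.max (mdist x y) (mdist y z).
  move=> /[dup] lxy /andP[xy hxy] /[dup] lyz /andP[yz hyz].
  have xz : x != z by apply/eqP => xz; move: (lt_asym _ _ lxy); rewrite xz lyz.
  (* If the distances differ, d(x,z) is the larger one, and the two points at the smaller distance
     have the same ball of the larger radius. If they agree, the balls of that radius are compared
     by transitivity; a smaller d(x,z) would make the outer two coincide, and by antisymmetry the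
     middle one too. *)
  have [dl|dl|dE] := ltgtP (mdist x y) (mdist y z).
  - have xzE : mdist x z = mdist y z.
      apply/eqP; rewrite eq_le; apply/andP; split.
        by rewrite (le_trans (um _ _ y))// ge_max ltW //= metric_sym.
      have := um y z x; rewrite le_max => /orP[|]; last by rewrite (metric_sym z).
      by rewrite (metric_sym y x) leNgt dl.
    split=> //; rewrite /lt xz /= /ba xzE (ultrametric_ball_eq um dl).
    by move: hyz; rewrite /ba (metric_sym z x) xzE (metric_sym z y).
  - have xzE : mdist x z = mdist x y.
      apply/eqP; rewrite eq_le; apply/andP; split.
        by rewrite (le_trans (um _ _ y))// ge_max lexx metric_sym ltW.
      have := um x y z; rewrite le_max => /orP[//|].
      by rewrite leNgt dl.
    split=> //; rewrite /lt xz /= /ba (metric_sym z x) xzE.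
    rewrite -(ultrametric_ball_eq um dl).
    by move: hxy; rewrite /ba (metric_sym y x).
  - have le1 : mdist x z <= mdist x y.
      by rewrite (le_trans (um _ _ y))// (metric_sym z) -dE maxxx.
    have hyz' : le0 (ball y (mdist x y)) (ball z (mdist x y)).
      by move: hyz; rewrite /ba (metric_sym z y) -dE.
    have hxy' : le0 (ball x (mdist x y)) (ball y (mdist x y)).
      by move: hxy; rewrite /ba (metric_sym y x).
    have xzE : mdist x z = mdist x y.
      apply/eqP; rewrite eq_le le1 leNgt; apply/negP => /(ultrametric_ball_eq um) bE.
      move/eqP: (ba_neq _ _ xy); apply; apply: anti0; rewrite hxy /=.
      by rewrite /ba (metric_sym y x) bE.
    split=> //; rewrite /lt xz /= /ba (metric_sym z x) xzE.
    exact: tr0 hxy' hyz'.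
pose le (x y : X) := (x == y) || lt x y.
exists le; split.
- move=> y x z /orP[/eqP->//|xy] /orP[/eqP<-|yz]; apply/orP; right => //.
  by have [] := key _ _ _ xy yz.
- move=> x y /andP[/orP[/eqP->//|xy] /orP[/eqP->//|]].
  by rewrite (negPf (lt_asym _ _ xy)).
- move=> x y; rewrite /le /lt (eq_sym y x); have [//|_] /= := eqVneq x y.
  exact: tot0.
- move=> x y z /orP[/eqP->|xy] /orP[/eqP<-|yz];
    rewrite ?mdistxx ?ge_max ?mdist_ge0 ?lexx//=.
  by have [_ ->] := key _ _ _ xy yz; rewrite !le_max !lexx orbT.
Qed.

(** * Content from covers of arbitrary mesh *)

Section cover_content.
Context (R : realType) (X : metricType R) (t : R).
Implicit Types (E V : set X).
Local Open Scope ereal_scope.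

Lemma ediam_ge0 E : 0 <= ediam E.
Proof. by apply: ereal_sup_ubound; left. Qed.

Lemma ediam_le E (r : R) : (0 <= r)%R ->
  (forall x y, E x -> E y -> (mdist x y <= r)%R) -> ediam E <= r%:E.
Proof.
move=> r0 Er; apply: ge_ereal_sup => _ [->|[[x y] [Ex Ey] <-]].
  by rewrite lee_fin.
by rewrite lee_fin; exact: Er.
Qed.

(** Without a bound on the mesh, this stays finite on a compact space even where the Hausdorff
    measure is infinite. *)
Definition cover_content E : \bar R :=
  ereal_inf [set \sum_(k <oo) ediam (U k) `^ t | U in
    [set U : (set X)^nat | E `<=` \bigcup_k U k]].

Lemma cover_content_ge0 E : 0 <= cover_content E.
Proof.
apply: le_ereal_inf_tmp => _ [U _ <-]; apply: nneseries_ge0 => *.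
exact: poweR_ge0.
Qed.

Lemma cover_content_le E E' : E `<=` E' -> cover_content E <= cover_content E'.
Proof.
move=> EE'; apply: ereal_inf_le_tmp => _ [U E'U <-]; exists U => //.
exact: subset_trans E'U.
Qed.

Lemma cover_contentU E V (r : R) : (0 <= t)%R -> (0 <= r)%R -> ediam V <= r%:E ->
  cover_content (E `|` V) <= cover_content E + (r `^ t)%:E.
Proof.
move=> t0 r0 Vr; rewrite -leeBlDr//; apply: le_ereal_inf_tmp => _ [U EU <-].
rewrite leeBlDr//.
pose W k := if k is k'.+1 then U k' else V.
apply: (@le_trans _ _ (\sum_(k <oo) ediam (W k) `^ t)).
  apply: ereal_inf_lbound; exists W => //; rewrite /= => x [/EU[k _ Ukx]|Vx].
    by exists k.+1.
  by exists 0%N.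
rewrite nneseries_recl//; last by move=> *; exact: poweR_ge0.
rewrite addeC -(@nneseries_addn _ (fun k => ediam (W k) `^ t))//; last first.
  by move=> *; exact: poweR_ge0.
rewrite leeD//; last first.
  rewrite -poweR_EFin; apply: gt0_ler_poweR; rewrite ?in_itv //=.
    by rewrite ediam_ge0 leey.
  by rewrite lee_fin r0 leey.
by apply: lee_nneseries => [*|k _]; rewrite ?poweR_ge0// addn1.
Qed.

Lemma cover_content_subsingleton E : (0 < t)%R ->
  (forall x y, E x -> E y -> x = y) -> cover_content E = 0.
Proof.
move=> t0 E1; apply/eqP; rewrite eq_le cover_content_ge0 andbT.
apply: ereal_inf_lbound; exists (fun=> E); first by move=> x Ex; exists 0%N.
rewrite eseries0// => k _ _; suff -> : ediam E = 0.
  by rewrite poweR_EFin powR0// gt_eqF.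
apply/eqP; rewrite eq_le ediam_ge0 andbT ediam_le// => x y Ex Ey.
by rewrite (E1 _ _ Ex Ey) mdistxx.
Qed.

(* If the content vanishes, the efficient covers consist of small sets only. *)
Lemma cover_content_gt0 E : (0 < t)%R ->
  0 < hausdorff_measure t E -> 0 < cover_content E.
Proof.
move=> t0; apply: contraTT; rewrite -!leNgt => E0.
apply: ge_ereal_sup => _ [e /= e0 <-].
apply/lee_addgt0Pr => d d0; rewrite add0e.
(* A sum below [e ^ t] forces every diameter to be at most e, so the cover is admissible at scale e;
   d bounds its sum. *)
have [|_ [U EU <-]] := @ereal_inf_lt R
    [set \sum_(k <oo) ediam (U k) `^ t | U in
    [set U : (set X)^nat | E `<=` \bigcup_k U k]] (Num.min d (e `^ t))%:E.
  by rewrite (le_lt_trans E0)// lte_fin lt_min d0 powR_gt0.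
rewrite EFin_min lt_min => /andP[Ud Ue].
apply: ge_ereal_inf; exists (\sum_(k <oo) ediam (U k) `^ t); last exact: ltW.
exists U => //; split=> // k; rewrite leNgt; apply/negP => ek.
have : ediam (U k) `^ t <= \sum_(k <oo) ediam (U k) `^ t.
  rewrite [leRHS](@nneseriesD1 _ _ k)//; last by move=> *; exact: poweR_ge0.
  by rewrite leeDl// nneseries_ge0// => *; exact: poweR_ge0.
move=> /le_lt_trans /(_ Ue); rewrite ltNge => /negP; apply.
rewrite -poweR_EFin; apply: gt0_ler_poweR; rewrite ?in_itv //= ?(ltW t0) ?(ltW ek)//.
  by rewrite lee_fin ltW//= leey.
by rewrite ediam_ge0 leey.
Qed.

End cover_content.

(** * Compactness and extremal points of convex orders *)

Lemma closure_mdist (R : realType) (X : metricType R) (E : set X) (x : X) :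
  closure E x -> forall e, 0 < e -> exists2 y, E y & mdist x y < e.
Proof.
move=> Ex e e0; have [y [Ey xy]] := Ex _ (nbhsx_ballx x _ e0).
by exists y => //; move: xy; rewrite ballEmdist.
Qed.

Lemma mdist_continuous (R : realType) (X : metricType R) (x : X) :
  continuous (mdist x).
Proof.
move=> p; apply/cvgrPdist_lt => e e0.
apply/nbhs_ballP; exists e => // y /=; rewrite ballEmdist /= => py.
have := metric_triangle x p y; have := metric_triangle x y p.
rewrite (metric_sym y p) => h1 h2; rewrite ltr_norml; lra.
Qed.

Lemma compact_le_mdist (R : realType) (X : metricType R) : compact [set: X] ->
  exists2 M : R, 0 <= M & forall x y : X, mdist x y <= M.
Proof.
move=> cX; have [[x0 _]|X0] := pselect ([set: X] !=set0); last first.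
  by exists 0 => // x; case: X0; exists x.
have [||c _ cmax] := @compact_EVT_max X R (mdist x0) setT _ cX.
- by exists x0.
- exact/continuous_subspaceT/mdist_continuous.
exists (mdist x0 c + mdist x0 c) => [|x y]; first by rewrite addr_ge0 ?mdist_ge0.
rewrite (le_trans (metric_triangle x x0 y))// lerD// ?(metric_sym x);
  exact: cmax (in_setT _).
Qed.

Section convex_order.
Context (R : realType) (X : metricType R).

Lemma convex_order_rev (le : rel X) :
  convex_order le -> convex_order (fun x y => le y x).
Proof.
move=> [tr anti tot conv]; split.
- by move=> y x z yx zy; exact: tr zy yx.
- by move=> x y /andP[yx xy]; apply: anti; rewrite xy.
- by move=> x y; exact: tot.
- move=> x y z yx zy; have := conv _ _ _ zy yx.
  by rewrite maxC (metric_sym x) (metric_sym y z) (metric_sym x z).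
Qed.

(** For y <= x < p convexity gives d(x,p) <= d(y,p), so the ball of radius d(x,p) around p misses
    the segment. *)
Lemma convex_order_le_closed (le : rel X) (x : X) :
  convex_order le -> closed [set y | le y x].
Proof.
move=> [tr anti tot conv] p pcl /=; apply/negPn/negP => npx.
have xp : le x p by have := tot p x; rewrite (negPf npx).
have d0 : 0 < mdist p x.
  by rewrite mdist_gt0; apply: contraNneq npx => ->; have := tot x x; rewrite orbb.
have [y /= yx py] := closure_mdist pcl d0.
have := conv _ _ _ yx xp; rewrite ge_max => /andP[_].
by rewrite (metric_sym x p) (metric_sym y p) leNgt py.
Qed.

(** The initial segments of C are nested; a cluster point lies in all of them because they are
    closed. *)
Lemma convex_order_min (le : rel X) (C : set X) :
  convex_order le -> compact C -> C !=set0 ->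
  exists2 m, C m & forall x, C x -> le m x.
Proof.
move=> co cC C0; have [tr anti tot _] := co.
have refl x : le x x by have := tot x x; rewrite orbb.
pose B x := C `&` [set y | le y x].
have FF : ProperFilter (filter_from C B).
  apply: filter_from_proper; last by move=> x Cx; exists x; split => /=.
  apply: filter_from_filter => // x y Cx Cy; have /orP[xy|yx] := tot x y.
    by exists x => // z [Cz zx]; split=> //; split=> //; exact: tr xy.
  by exists y => // z [Cz zy]; split=> //; split=> //; exact: tr yx.
have [|m [Cm]] := cC (filter_from C B).
- by case: C0 => x Cx; exists x => // y [].
rewrite clusterE => mcl; exists m => // x Cx.
apply: (convex_order_le_closed co).
have /closure_subset : B x `<=` [set y | le y x] by move=> y [].
apply; apply: mcl; exists x => // y; apply.
Qed.

End convex_order.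

(** * The content of initial segments as a Hölder function *)

Lemma cover_content_fin_num (R : realType) (X : metricType R) (t : R) (E : set X) :
  0 < t -> compact [set: X] -> cover_content t E \is a fin_num.
Proof.
move=> t0 cX; have [M M0 XM] := compact_le_mdist cX.
rewrite ge0_fin_numE ?cover_content_ge0//.
have -> : E = set0 `|` E by rewrite set0U.
apply: le_lt_trans (cover_contentU set0 (ltW t0) M0 _) _.
  by apply: ediam_le => // x y _ _; exact: XM.
by rewrite cover_content_subsingleton// add0e ltry.
Qed.

Section content_function.
Context (R : realType) (X : metricType R) (t : R) (le : rel X).
Context (t0 : 0 < t) (cX : compact [set: X]) (co : convex_order le).

Let F (x : X) : R := fine (cover_content t [set y | le y x]).

Let fin_content E := cover_content_fin_num E t0 cX.

Let F_le x z : le x z -> F x <= F z.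
Proof.
have [tr _ _ _] := co.
by move=> xz; rewrite fine_le// cover_content_le// => y /= yx; exact: tr xz.
Qed.

Let F_le_mdist x z : le x z -> F z <= F x + mdist x z `^ t.
Proof.
have [tr anti tot conv] := co => xz.
rewrite -lee_fin EFinD !fineK//.
pose V := [set y | le x y /\ le y z].
apply: (@le_trans _ _ (cover_content t ([set y | le y x] `|` V))).
  apply: cover_content_le => y /= yz.
  by have /orP[] := tot y x; [left|right].
apply: cover_contentU; rewrite ?mdist_ge0 ?(ltW t0)//.
apply: ediam_le; rewrite ?mdist_ge0// => u v.
wlog uv : u v / le u v.
  by move=> h; have /orP[] := tot u v => [/h//|/h {}h uV vV]; rewrite metric_sym h.
(* For x <= u <= v <= z, convexity used twice gives d(u,v) <= d(x,v) <= d(x,z). *)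
move=> [xu uz] [xv vz]; have := conv _ _ _ xu uv; rewrite ge_max => /andP[_ h].
by have := conv _ _ _ xv vz; rewrite ge_max => /andP[/(le_trans h)].
Qed.

Lemma content_function_hoelder x z :
  `|F x - F z| <= mdist x z `^ t.
Proof.
have [_ _ tot _] := co; wlog xz : x z / le x z.
  move=> h; have /orP[/h//|/h] := tot x z.
  by rewrite distrC metric_sym.
have := F_le xz; have := F_le_mdist xz => h1 h2; rewrite ler_norml; lra.
Qed.

Let F_closed (C : set R) : closed C -> closed [set x | C (F x)].
Proof.
suff Fc : continuous F by exact: (continuous_closedP F).1.
move=> p; apply/cvgrPdist_lt => e e0.
apply/nbhs_ballP; exists (e `^ t^-1); rewrite /= ?powR_gt0// => y.
rewrite ballEmdist /= => py; apply: le_lt_trans (content_function_hoelder _ _) _.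
have -> : e = (e `^ t^-1) `^ t by rewrite -powRrM mulVf ?gt_eqF// powRr1// ltW.
by rewrite gt0_ltr_powR// nnegrE ?mdist_ge0 ?powR_ge0.
Qed.

(* In the order, the sets F <= c and F >= c cannot be separated by a jump,
   since points have zero content. *)
Lemma content_function_onto (c : R) :
  0 <= c <= fine (cover_content t [set: X]) -> [set: X] !=set0 ->
  exists x, F x = c.
Proof.
move=> /andP[c0 cM] X0; have [tr anti tot conv] := co.
have [a _ amin] := convex_order_min co cX X0.
have [b _ bmax] := convex_order_min (convex_order_rev co) cX X0.
have Fa : F a = 0.
  rewrite /F cover_content_subsingleton// => x y /= xa ya.
  by rewrite (anti x a) ?xa ?amin// (anti y a) ?ya ?amin.
have Fb : F b = fine (cover_content t [set: X]).
  by congr (fine (cover_content t _)); apply/seteqP; split => // x _; exact: bmax.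
have [||m Fm mmax] := @convex_order_min _ _ _ [set x | F x <= c] (convex_order_rev co).
- apply: subclosed_compact cX _ => //.
  exact: (F_closed (@closed_le _ c)).
- by exists a; rewrite /= Fa.
have [||M FM Mmin] := @convex_order_min _ _ _ [set x | c <= F x] co.
- apply: subclosed_compact cX _ => //.
  exact: (F_closed (@closed_ge _ c)).
- by exists b; rewrite /= Fb.
have [Mm|mM] := boolP (le M m).
  by exists m; apply/eqP; rewrite eq_le Fm (le_trans FM)// F_le.
suff FMm : F M <= F m.
  by exists m; apply/eqP; rewrite eq_le Fm (le_trans FM).
rewrite fine_le//.
(* A point y <= [M] has F y <= c, hence y <= [m], or c <= F y, hence y = [M]. The extra point is a
   set of diameter 0. *)
apply: (@le_trans _ _ (cover_content t ([set y | le y m] `|` [set M]))).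
  apply: cover_content_le => y /= yM.
  have [yc|/ltW yc] := leP (F y) c; first by left; exact: mmax.
  by right; apply: anti; rewrite yM Mmin.
apply: le_trans (cover_contentU _ (ltW t0) (lexx 0) _) _.
  by apply: ediam_le => // x y -> ->; rewrite mdistxx.
by rewrite powR0 ?gt_eqF// adde0.
Qed.

End content_function.

Lemma ultrametric_hoelder_onto (R : realType) (t : R) (A : metricType R) :
  0 < t -> compact [set: A] -> ultrametric A ->
  (0 < hausdorff_measure t [set: A])%E ->
  exists (F : A -> R) (M : R), [/\ 0 < M,
    forall x z, `|F x - F z| <= mdist x z `^ t &
    forall c, 0 <= c <= M -> exists x, F x = c].
Proof.
move=> t0 cA um /(cover_content_gt0 t0) cA0.
have [le co] := ultrametric_convex_order um.
exists (fun x => fine (cover_content t [set y | le y x])).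
exists (fine (cover_content t [set: A])); split.
- by rewrite fine_gt0// cA0 ltey_eq cover_content_fin_num.
- exact: content_function_hoelder.
- move=> c cM; apply: content_function_onto => //.
  apply/set0P/negP => /eqP A0; move: cA0; rewrite A0.
  by rewrite cover_content_subsingleton// ltxx.
Qed.

(** * Potentials of ordered finite families *)

Section chain_potential.
Context (R : realType) (X : metricType R) (s : R) (n : nat) (x : 'I_n.+1 -> X).

Let lt_ord := fun i j : 'I_n.+1 => (i < j)%N.

(** The sum in [chain_max], on sequences instead of tuples so that chains can be extended. *)
Let chain_sum (p : seq 'I_n.+1) : R :=
  \sum_(j < size p) mdist (x (nth ord0 (ord0 :: p) j))
                          (x (nth ord0 (ord0 :: p) j.+1)) `^ s.

Let chain_sum_rcons p j :
  chain_sum (rcons p j) = chain_sum p + mdist (x (last ord0 p)) (x j) `^ s.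
Proof.
have nthE k : (k <= size p)%N ->
    nth ord0 (ord0 :: rcons p j) k = nth ord0 (ord0 :: p) k.
  by case: k => //= k kp; rewrite nth_rcons kp.
rewrite /chain_sum size_rcons big_ord_recr; congr (_ + _).
  by apply: eq_bigr => i _; rewrite (nthE i) ?(nthE i.+1)// ltnW.
by rewrite nthE// -last_nth /= nth_rcons ltnn eqxx.
Qed.

Let chain_sum_le_max p : path lt_ord ord0 p -> last ord0 p = ord_max ->
  chain_sum p <= chain_max s x.
Proof.
(* A strictly increasing chain has no repetition, so its length is among those in [chain_max]. *)
move=> pp lp; have sp : (size p < n.+1)%N.
  have lt_tr : transitive lt_ord by move=> a b c; exact: ltn_trans.
  have := sorted_uniq lt_tr (fun i => ltnn i) (pp : sorted lt_ord (ord0 :: p)).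
  by move=> /card_uniqP /= sE; rewrite -sE (leq_trans (max_card _))// card_ord.
apply: (bigmax_sup (Ordinal sp)) => //; apply: (bigmax_sup (in_tuple p)) => //=.
by rewrite pp lp eqxx.
Qed.

(* The potential of i is the largest sum of a chain from 0 to i. *)
Lemma chain_potential : exists g : 'I_n.+1 -> R,
  (forall i, 0 <= g i <= chain_max s x) /\
  (forall i j : 'I_n.+1, (i < j)%N -> mdist (x i) (x j) `^ s <= g j - g i).
Proof.
pose S i := [set chain_sum p | p in [set p | path lt_ord ord0 p /\ last ord0 p = i]].
have S0 i : S i !=set0.
  have [->|i0] := eqVneq i ord0; first by exists (chain_sum [::]); exists [::].
  exists (chain_sum [:: i]); exists [:: i] => //=; split=> //.
  by rewrite andbT /lt_ord lt0n.
have Sub i : ubound (S i) (chain_max s x).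
  move=> _ [p [pp lp] <-]; have [im|im] := eqVneq i ord_max.
    by apply: chain_sum_le_max; rewrite // lp.
  (* Prolonging the chain to the last index only adds a nonnegative term. *)
  apply: (@le_trans _ _ (chain_sum (rcons p ord_max))).
    by rewrite chain_sum_rcons lerDl powR_ge0.
  apply: chain_sum_le_max; rewrite ?last_rcons// rcons_path pp lp /=.
  by rewrite /lt_ord /= ltn_neqAle -ltnS ltn_ord andbT.
have Ssup i : has_sup (S i) by split=> //; exists (chain_max s x).
exists (fun i => sup (S i)); split=> [i|i j ij].
  apply/andP; split; last exact: ge_sup.
  have [r Sr] := S0 i; apply: le_trans (sup_ubound (Ssup i).2 Sr).
  by case: Sr => p _ <-; rewrite sumr_ge0// => *; exact: powR_ge0.
rewrite lerBrDl -lerBrDr; apply: ge_sup => // _ [p [pp lp] <-].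
rewrite lerBrDr; apply: sup_ubound; first exact: (Ssup j).2.
exists (rcons p j); last by rewrite chain_sum_rcons lp.
by split; rewrite ?last_rcons// rcons_path pp lp.
Qed.

End chain_potential.

(** * Nearest-point retractions *)

(** If y is closer to x than C is, both have the same nearest points, and [xget] sees only this set,
    so the images agree. Otherwise both points move by at most d(x,y), and the ultrametric
    inequality bounds the distance of the images. *)
Lemma ultrametric_retraction (R : realType) (X : metricType R) (C : set X) :
  ultrametric X -> compact C -> C !=set0 ->
  exists r : X -> X, [/\ forall x, C (r x), forall x, C x -> r x = x &
    forall x y, mdist (r x) (r y) <= mdist x y].
Proof.
move=> um cC [c0 Cc0].
pose N x := [set p | C p /\ forall q, C q -> mdist x p <= mdist x q].
have N0 x : N x !=set0.
  have [||p Cp pmin] := @compact_EVT_min X R (mdist x) C _ cC.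
  - by exists c0.
  - exact/continuous_subspaceT/mdist_continuous.
  by exists p; split; [exact/set_mem|move=> q /mem_set /pmin].
have Nr x : N x (xget c0 (N x)) by have [p Np] := N0 x; exact: xgetI Np.
exists (fun x => xget c0 (N x)); split=> [x|x Cx|x y].
- by have [] := Nr x.
- have [_ /(_ x Cx)] := Nr x; rewrite mdistxx => r0.
  by apply/esym/mdist_positivity/eqP; rewrite eq_le r0 mdist_ge0.
wlog suff near : x y / mdist x y < mdist x (xget c0 (N x)) -> N x = N y.
  have [/near->|xr] := ltP (mdist x y) (mdist x (xget c0 (N x))).
    by rewrite mdistxx mdist_ge0.
  rewrite metric_sym; have [/near->|yr] := ltP (mdist y x) (mdist y (xget c0 (N y))).
    by rewrite mdistxx mdist_ge0.
  rewrite (le_trans (um _ _ x))// ge_max ![mdist _ x]metric_sym xr andbT.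
  rewrite (le_trans (um _ _ y))// ge_max lexx /=.
  by rewrite [mdist _ y]metric_sym (metric_sym x).
move=> xy; have dE q : C q -> mdist x q = mdist y q.
  move=> Cq; have xq : mdist x y < mdist x q.
    by apply: lt_le_trans xy _; have [_] := Nr x; exact.
  apply/eqP; rewrite eq_le; apply/andP; split.
    have := um x q y; rewrite le_max leNgt xq /=.
    by rewrite (metric_sym q).
  have := um y q x; rewrite (metric_sym q) => /le_trans; apply.
  by rewrite ge_max (metric_sym y) ltW //=.
by apply/seteqP; split=> p [Cp pmin]; split=> // q Cq; have := pmin q Cq; rewrite !dE.
Qed.

(** * Sections from B to A and their inverses *)

(** Right continuity of the power, also at 0, in the form used for limits: y solves K y^a = m with m
    halfway between the two sides, and e is chosen with x + e <= y. *)
Lemma powR_right_limit (R : realType) (K x r a : R) : 0 < K -> 0 <= x -> 0 < a ->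
  (forall e, 0 < e -> r <= e + K * (x + e) `^ a) -> r <= K * x `^ a.
Proof.
move=> K0 x0 a0 lim; rewrite leNgt; apply/negP => rx.
pose m := (r + K * x `^ a) / 2.
have m1 : K * x `^ a < m by rewrite /m; lra.
have m2 : m < r by rewrite /m; lra.
have mK : 0 < m / K.
  by rewrite divr_gt0// (le_lt_trans _ m1)// mulr_ge0 ?powR_ge0// ltW.
pose y := (m / K) `^ a^-1.
have yE : K * y `^ a = m.
  by rewrite -powRrM mulVf ?gt_eqF// powRr1 ?(ltW mK)// mulrC divfK ?gt_eqF.
have xy : x < y.
  rewrite ltNge; apply/negP => yx; move: m1; rewrite ltNge => /negP; apply.
  rewrite -yE ler_pM2l//; apply: ge0_ler_powR; rewrite ?nnegrE ?powR_ge0//.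
  exact: ltW.
pose e := Num.min (y - x) ((r - m) / 2).
have e0 : 0 < e by rewrite lt_min subr_gt0 xy divr_gt0// subr_gt0.
have ey : x + e <= y by rewrite -lerBrDl ge_min lexx.
have er : e <= (r - m) / 2 by rewrite ge_min lexx orbT.
have : K * (x + e) `^ a <= m.
  rewrite -yE ler_pM2l//; apply: ge0_ler_powR; rewrite ?nnegrE ?powR_ge0 ?(ltW a0)//.
  by rewrite addr_ge0// ltW.
by have := lim e e0 => h1 h2; lra.
Qed.

Lemma hoelder_finite_section (R : realType) (s t : R) (A B : metricType R)
    (F : A -> R) (M D : R) (l : seq B) :
  0 < s -> 0 < M -> 0 < D -> (delta s B <= D%:E)%E ->
  (forall x z, `|F x - F z| <= mdist x z `^ t) ->
  (forall c, 0 <= c <= M -> exists x, F x = c) ->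
  exists a : B -> A, forall b b', b \in l -> b' \in l ->
    mdist b b' `^ s <= D / M * mdist (a b) (a b') `^ t.
Proof.
move=> s0 M0 D0 dD FH Fsurj.
case: l => [|b0 l'].
  (* For an empty list only a point of A is required; surjectivity of F supplies one. *)
  by have [|a0 _] := Fsurj 0; [rewrite lexx ltW|exists (fun=> a0)].
set l := b0 :: l'; pose n := size l'; pose x (i : 'I_n.+1) := nth b0 l i.
have xD : order_min s x <= D.
  by rewrite -lee_fin (le_trans _ dD)//; apply: ereal_sup_ubound; exists n, x.
(* If the bound comes from the default value of the minimum, the identity permutation attains it. *)
have [pi piD] : exists pi : 'S_n.+1, chain_max s (x \o pi) <= D.
  move/bigmin_leP: xD => [xD|[pi _ piD]]; last by exists pi.
  exists 1%g; rewrite (_ : x \o _ = x)//.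
  by apply/funext => i; rewrite /= perm1.
have [g [gD gd]] := chain_potential s (x \o pi).
(* The factor M / D carries the range [0, D] of the potential into the range [0, M] covered by F. *)
have /choice[c cE] : forall i, exists a, F a = g i * (M / D).
  move=> i; apply: Fsurj; have /andP[g0 g1] := gD i.
  rewrite mulr_ge0 ?divr_ge0 ?(ltW M0) ?(ltW D0)//=.
  by rewrite mulrA ler_pdivrMr// mulrC ler_pM2l// (le_trans g1).
(* The place of b in the order given by [pi]. *)
pose k b : 'I_n.+1 := (pi^-1)%g (inord (index b l)).
have kE b : b \in l -> x (pi (k b)) = b.
  move=> bl; have il : (index b l < n.+1)%N by move: bl; rewrite -index_mem.
  by rewrite /k permKV /x inordK// nth_index.
exists (c \o k) => b b' bl b'l /=.
wlog kk : b b' bl b'l / (k b <= k b')%N.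
  move=> h; have /orP[/h->//|/h] := leq_total (k b) (k b').
  by rewrite (metric_sym b) (metric_sym (c _)); apply.
have [kE'|kN] := eqVneq (k b) (k b').
  by rewrite -(kE b bl) kE' (kE b') // mdistxx powR0 ?gt_eqF//
    mulr_ge0 ?divr_ge0 ?powR_ge0 ?ltW.
have /gd : (k b < k b')%N by rewrite ltn_neqAle kk andbT.
rewrite /= !kE// => /le_trans; apply.
rewrite -ler_pdivrMl ?divr_gt0// invf_div.
apply: le_trans (FH _ _); rewrite distrC !cE -mulrBl mulrC; exact: ler_norm.
Qed.

(* Tychonoff in A^B turns sections over finite sets into a global one. *)
Lemma hoelder_section (R : realType) (A B : metricType R) (K al : R) :
  0 < K -> 0 < al -> compact [set: A] ->
  (forall l : seq B, exists a : B -> A, forall b b', b \in l -> b' \in l ->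
    mdist b b' <= K * mdist (a b) (a b') `^ al) ->
  exists a : B -> A, forall b b', mdist b b' <= K * mdist (a b) (a b') `^ al.
Proof.
move=> K0 al0 cA fin.
have := @tychonoff B (fun=> A) (fun=> setT) (fun=> cA).
pose S (l : seq B) : set (prod_topology (fun _ : B => A)) :=
  [set a | forall b b', b \in l -> b' \in l ->
    mdist b b' <= K * mdist (a b) (a b') `^ al].
have FF : ProperFilter (filter_from setT S).
  apply: filter_from_proper; last by move=> l _; exact: fin.
  apply: filter_from_filter; first by exists [::].
  move=> l l' _ _; exists (l ++ l') => // a Sa.
  by split=> b b' bl b'l; apply: Sa; rewrite mem_cat ?bl ?b'l ?orbT.
move=> /(_ (filter_from setT S) FF) [].
  by exists [::].
move=> a [_]; rewrite clusterE => acl; exists a => b b'.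
(* A section a' for [b; b'] lies within e / 2 of a at both points, which enlarges the distance by at
   most e. *)
apply: powR_right_limit; rewrite ?mdist_ge0// => e e0.
have e2 : 0 < e / 2 by rewrite divr_gt0.
have nb (c : B) : nbhs (a : prod_topology (fun=> A))
    [set a' : B -> A | mdist (a c) (a' c) < e / 2].
  have := @proj_continuous B (fun=> A) c a _ (nbhsx_ballx (a c) (e / 2) e2).
  by rewrite ballEmdist.
have Scl : closure (S [:: b; b']) a by apply: acl; exists [:: b; b'].
have [|a' [Sa' [/= h1 h2]]] := Scl ([set a' : B -> A | mdist (a b) (a' b) < e / 2] `&`
    [set a' : B -> A | mdist (a b') (a' b') < e / 2]).
  by apply: filterI; exact: nb.
have := Sa' b b'; rewrite !inE !eqxx orbT => /(_ isT isT) /le_trans; apply.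
apply: ler_wpDl; first exact: ltW.
rewrite ler_pM2l//; apply: ge0_ler_powR; rewrite ?nnegrE ?mdist_ge0 ?(ltW al0)//.
  by rewrite addr_ge0 ?mdist_ge0 ?ltW.
have := metric_triangle (a' b) (a b) (a' b'); have := metric_triangle (a b) (a b') (a' b').
rewrite (metric_sym (a' b) (a b)); lra.
Qed.

(* The section is inverted on the closure of its range, and the inverse is
   composed with a retraction onto this closure. *)
Lemma hoelder_surjection (R : realType) (A B : metricType R) (K al : R)
    (a : B -> A) :
  0 < K -> 0 < al -> ultrametric A -> compact [set: A] -> compact [set: B] ->
  [set: B] !=set0 ->
  (forall b b', mdist b b' <= K * mdist (a b) (a b') `^ al) ->
  exists f : A -> B, (forall x z, mdist (f x) (f z) <= K * mdist x z `^ al) /\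
    forall b, f (a b) = b.
Proof.
move=> K0 al0 um cA cB [b0 _] aK.
pose C := closure (range a).
have cC : compact C by apply: subclosed_compact cA _ => //; exact: closed_closure.
have Ca b : C (a b) by apply: subset_closure; exists b.
have [|r [rC rid rlip]] := ultrametric_retraction um cC; first by exists (a b0).
(* The closure of the graph of the inverse, the pairs (a b, b). The estimate passes to it and makes
   it single-valued; compactness of B makes it total over C. *)
pose H x y := forall e, 0 < e -> exists2 b, mdist x (a b) < e & mdist y b < e.
have HH x y x' y' : H x y -> H x' y' -> mdist y y' <= K * mdist x x' `^ al.
  move=> xy xy'; apply: powR_right_limit; rewrite ?mdist_ge0// => e e0.
  have e2 : 0 < e / 2 by rewrite divr_gt0.
  have [b xb yb] := xy _ e2; have [b' xb' yb'] := xy' _ e2.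
  have : K * mdist (a b) (a b') `^ al <= K * (mdist x x' + e) `^ al.
    rewrite ler_pM2l//; apply: ge0_ler_powR; rewrite ?nnegrE ?mdist_ge0 ?(ltW al0)//.
      by rewrite addr_ge0 ?mdist_ge0 ?ltW.
    have := metric_triangle (a b) x (a b'); have := metric_triangle x x' (a b').
    rewrite (metric_sym (a b) x); lra.
  have := aK b b'; have := metric_triangle y b y'; have := metric_triangle b b' y'.
  rewrite (metric_sym b' y'); lra.
have H_total x : C x -> exists y, H x y.
  move=> Cx; pose S e := [set b | mdist x (a b) < e].
  have FF : ProperFilter (filter_from [set e : R | 0 < e] S).
    apply: filter_from_proper; last first.
      by move=> e e0; have [_ [b _ <-] xb] := closure_mdist Cx e0; exists b.
    apply: filter_from_filter; first by exists 1 => /=.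
    move=> e e' e0 e'0; exists (Num.min e e'); first by rewrite /= lt_min e0.
    by move=> b; rewrite /S /= lt_min => /andP[].
  have [|y [_]] := cB (filter_from [set e : R | 0 < e] S).
    by exists 1 => /=.
  rewrite clusterE => ycl; exists y => e e0.
  have [|b xb yb] := @closure_mdist _ _ (S e) y _ e e0; last by exists b.
  by apply: ycl; exists e.
have /choice[f fH] : forall x, exists y, H (r x) y by move=> x; exact: H_total.
exists f; split=> [x z|b].
  apply: le_trans (HH _ _ _ _ (fH x) (fH z)) _.
  rewrite ler_pM2l//; apply: ge0_ler_powR; rewrite ?nnegrE ?mdist_ge0 ?(ltW al0)//.
have Hb : H (a b) b by move=> e e0; exists b; rewrite mdistxx.
have := HH _ _ _ _ (fH (a b)) Hb; rewrite rid// mdistxx powR0 ?gt_eqF// mulr0 => le0.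
by apply: mdist_positivity; apply/eqP; rewrite eq_le le0 mdist_ge0.
Qed.

Unset Implicit Arguments.

Theorem proposition4p1 (R : realType) (s t : R) (hs : 0 < s) (ht : 0 < t)
    (A B : metricType R)
    (hAcompact : compact [set: A]) (hAultra : ultrametric A)
    (hApos : (0 < hausdorff_measure t [set: A])%E)
    (hBne : [set: B] !=set0) (hBcompact : compact [set: B])
    (hBdelta : (delta s B < +oo)%E) :
  (exists A' : set A, compact A' /\
     exists f : A -> B, hoelder_on (t / s) A' f /\ set_surj A' [set: B] f) /\
  (t = s ->
     exists f : A -> B, lipschitz_map f /\ set_surj [set: A] [set: B] f).
Proof.
suff [f fH fsurj] : exists2 f : A -> B,
    hoelder_on (t / s) [set: A] f & set_surj [set: A] [set: B] f.
  split; first by exists setT; split=> //; exists f.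
  by move=> ts; exists f; split=> //; move: fH; rewrite ts divff ?gt_eqF.
have [F [M [M0 FH Fsurj]]] := ultrametric_hoelder_onto ht hAcompact hAultra hApos.
(* The maximum with 1 keeps D positive when [delta] is 0. *)
have [D D0 dD] : exists2 D : R, 0 < D & (delta s B <= D%:E)%E.
  case: (delta s B) hBdelta => [d _|//|_]; last by exists 1 => //; exact: leNye.
  by exists (Num.max d 1); rewrite ?lt_max ?ltr01 ?orbT// lee_fin le_max lexx.
(* Taking s-th roots in the finite estimate gives this constant and the exponent t / s. *)
pose K := (D / M) `^ s^-1.
have K0 : 0 < K by rewrite powR_gt0// divr_gt0.
have ts0 : 0 < t / s by rewrite divr_gt0.
have [|a aK] := hoelder_section K0 ts0 hAcompact (B := B).
  move=> l; have [a aH] := hoelder_finite_section l hs M0 D0 dD FH Fsurj.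
  exists a => b b' bl b'l.
  have -> : mdist b b' = (mdist b b' `^ s) `^ s^-1.
    by rewrite -powRrM divff ?gt_eqF// powRr1 ?mdist_ge0.
  rewrite powRrM -powRM ?powR_ge0 ?divr_ge0 ?(ltW D0) ?(ltW M0)//.
  have DM0 : 0 <= D / M by rewrite divr_ge0 ?ltW.
  apply: ge0_ler_powR; rewrite ?nnegrE ?powR_ge0 ?invr_ge0 ?(ltW hs) ?aH//.
  by rewrite mulr_ge0// powR_ge0.
have [f [fH fa]] := hoelder_surjection K0 ts0 hAultra hAcompact hBcompact hBne aK.
exists f; first by exists K => x z _ _; exact: fH.
by move=> b _; exists (a b).
Qed.
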